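(* Let $G=(V,E)$ be a graph with $V=\{1,2,\ldots,n\}$ and $|E|=m$, and let $f:V\to\mathbb{N}^+$ satisfy $\sum_{u\in V}f(u)=m+n$. Let $C_f$ denote the set of all proper colorings $c:V\to\{0,1,\ldots,\max\{f(i)-1:1\le i\le n\}\}$ of $G$. Then $G$ is $f$-AT if and only if $$\sum_{c\in C_f}(-1)^{\sum_{i=1}^n c(i)}\prod_{i=1}^n\binom{f(i)-1}{c(i)}P_G(c(1),\ldots,c(n))\neq 0.$$
   Context: The graph polynomial of $G$ is $P_G(x_1,\ldots,x_n)=\prod_{1\le i<j\le n,\ (i,j)\in E}(x_i-x_j)$ ($P_G\equiv1$ if $E=\emptyset$). For $f:V\to\mathbb{N}^+$, $G$ is called Alon-Tarsi $f$-choosable ($f$-AT) if the expansion of $P_G$ contains a monomial $c\prod_{i=1}^n x_i^{t_i}$ with real coefficient $c\neq0$ and $t_i\le f(i)-1$ for all $i$. A proper coloring assigns distinct colors to adjacent vertices. Binomial coefficients $\binom{a}{b}$ with $b>a$ are $0$. *)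

(* Defs.v *)
From mathcomp Require Import all_boot all_order all_algebra.
From mathcomp Require Import reals.
From mathcomp Require Import mpoly.
Set Implicit Arguments.
Unset Strict Implicit.
Unset Printing Implicit Defensive.
Import GRing.Theory.
Local Open Scope ring_scope.

Record sgraph (n : nat) := SGraph {
  adj :> rel 'I_n;
  adj_sym : ssrbool.symmetric adj;
  adj_irrefl : irreflexive adj
}.

(* Each unordered edge is represented once, by its increasing pair. *)
Definition edges n (G : sgraph n) : {set 'I_n * 'I_n} :=
  [set e : 'I_n * 'I_n | (e.1 < e.2)%N && G e.1 e.2].

Definition graph_poly (R : nzRingType) n (G : sgraph n) : {mpoly R[n]} :=
  \prod_(e in edges G) ('X_(e.1) - 'X_(e.2)).

Definition alon_tarsi_choosable (R : nzRingType) n (G : sgraph n)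
    (f : 'I_n -> nat) : Prop :=
  exists t : 'X_{1..n},
    (graph_poly R G)@_t != 0 /\ forall i : 'I_n, (t i <= f i - 1)%N.

Definition proper_coloring n (G : sgraph n) (C : eqType) (c : 'I_n -> C) : bool :=
  [forall i, forall j, G i j ==> (c i != c j)].

Definition max_color n (f : 'I_n -> nat) : nat := (\max_(i < n) (f i - 1))%N.

(* ['I_(max_color f).+1] is the color set {0, ..., max_color f}. *)
Definition proper_colorings n (G : sgraph n) (f : 'I_n -> nat) :
    {set {ffun 'I_n -> 'I_(max_color f).+1}} :=
  [set c : {ffun 'I_n -> 'I_(max_color f).+1} | proper_coloring G c].

(* Main.v *)
Require Import Defs.
From mathcomp Require Import all_boot all_order all_algebra.
From mathcomp Require Import reals.
From mathcomp Require Import mpoly.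
From mathcomp Require Import ring.
Set Implicit Arguments.
Unset Strict Implicit.
Unset Printing Implicit Defensive.
Import GRing.Theory.
Local Open Scope ring_scope.

(** Put [d i = f i - 1].  The polynomial [P_G] is homogeneous of degree
    [m = \sum_i d i], so [G] is [f]-AT iff the coefficient of [x^d] in [P_G] is
    nonzero.  The sum is an iterated finite difference, of order [d i] in the
    [i]-th variable: it kills every monomial of degree [m] other than [x^d], since
    such a monomial has degree less than [d i] in some variable, and it sends
    [x^d] to [\prod_i (-1)^(d i) (d i)!].  Improper colorings are zeros of
    [P_G]. *)

(** Pascal's rule makes the sum telescope. For [N > d] the right side is zero, which is the
    exponent-zero case of the next lemma. *)
Lemma sum_signed_binS (R : nzRingType) (d N : nat) :
  \sum_(k < N.+1) (-1) ^+ k * 'C(d.+1, k)%:R = (-1) ^+ N * 'C(d, N)%:R :> R.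
Proof.
elim: N => [|N IHN]; first by rewrite big_ord1 !bin0.
rewrite big_ord_recr IHN /= binS natrD mulrDr exprS mulN1r !mulNr.
by rewrite addrCA subrr addr0.
Qed.

(** Induction on the order [d]. The upper limit [N] may exceed [d], because all vertices share one
    color range; the extra binomials vanish. *)
Lemma finite_difference_exp (R : comNzRingType) (d t N : nat) :
  (t <= d)%N -> (d <= N)%N ->
  \sum_(k < N.+1) (-1) ^+ k * 'C(d, k)%:R * k%:R ^+ t =
  (t == d)%:R * ((-1) ^+ d * d`!%:R) :> R.
Proof.
elim: d t N => [|d IHd] [|t] N //.
  move=> _ _; rewrite big_ord_recl big1 => [|k _]; last by rewrite bin0n mulr0 mul0r.
  by rewrite addr0 bin0 !mulr1.
- move=> _ ltdN; under eq_bigr do rewrite expr0 mulr1.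
  by rewrite sum_signed_binS bin_small // mulr0 mul0r.
case: N => // N letd ledN.
rewrite big_ord_recl exprS mul0r mulr0 add0r.
(* After the shift of [k] by one, absorption [(k+1) C(d+1,k+1) = (d+1) C(d,k)] lowers the order, and
   the binomial theorem expands [(k+1)^t]. *)
transitivity (- d.+1%:R * \sum_(s < t.+1) 'C(t, s)%:R *
    \sum_(k < N.+1) (-1) ^+ k * 'C(d, k)%:R * k%:R ^+ s : R).
  under [in RHS]eq_bigr do rewrite mulr_sumr.
  rewrite exchange_big mulr_sumr; apply: eq_bigr => k _ /=.
  rewrite /bump /= add1n exprS [(k.+1%:R) ^+ _]exprS mulrA -[X in X * _]mulrA.
  rewrite -natrM [('C(_, _) * _)%N]mulnC -mul_bin_diag natrM /=.
  have -> : k.+1%:R ^+ t = \sum_(s < t.+1) 'C(t, s)%:R * k%:R ^+ s :> R.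
    by rewrite -natr1 exprD1n; apply: eq_bigr => s _; rewrite mulr_natl.
  rewrite !mulr_sumr; apply: eq_bigr => s _.
  by ring.
have diff_s (s : 'I_t.+1) : \sum_(k < N.+1) (-1) ^+ k * 'C(d, k)%:R * k%:R ^+ s =
    (s == d :> nat)%:R * ((-1) ^+ d * d`!%:R) :> R.
  by rewrite IHd //; exact: leq_trans (ltn_ord s) letd.
under eq_bigr do rewrite diff_s.
(* Since [s <= t <= d], only the top index [s = t] can equal [d]. *)
rewrite big_ord_recr big1 /= => [|s _]; last first.
  by rewrite ltn_eqF ?mul0r ?mulr0 // (leq_trans (ltn_ord s)).
rewrite add0r binn mul1r eqSS factS natrM exprS.
by ring.
Qed.

Lemma multinom_eq_of_le (n : nat) (s t : 'X_{1..n}) :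
  mdeg s = mdeg t -> (forall i, (s i <= t i)%N) -> s = t.
Proof.
move=> eq_deg le_st; apply/mnmP => i.
have [_] := leqif_sum (fun i (_ : true) => leqif_eq (le_st i)).
by rewrite -!mdegE eq_deg eqxx => /esym/forallP/(_ i)/eqP.
Qed.

Lemma mcoeff_finite_difference (R : comNzRingType) (n N : nat)
    (p : {mpoly R[n]}) (d : 'X_{1..n}) :
  p \is (mdeg d).-homog -> (forall i, (d i <= N)%N) ->
  \sum_(c : {ffun 'I_n -> 'I_N.+1})
     (-1) ^+ (\sum_(i < n) c i)%N * (\prod_(i < n) 'C(d i, c i))%N%:R *
     p.@[fun i => (c i)%:R] =
  p@_d * \prod_(i < n) ((-1) ^+ d i * (d i)`!%:R).
Proof.
move=> /dhomogP p_homog le_dN.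
(* On each monomial the sum over colorings factors into one-variable sums. *)
transitivity (\sum_(t <- msupp p) p@_t *
    \prod_(i < n) \sum_(k < N.+1) (-1) ^+ k * 'C(d i, k)%:R * k%:R ^+ t i).
  under [RHS]eq_bigr do rewrite bigA_distr_bigA mulr_sumr.
  rewrite exchange_big; apply: eq_bigr => c _ /=.
  rewrite mevalE mulr_sumr; apply: eq_bigr => t _.
  by rewrite -prodrXr natr_prod !big_split /= mulrCA.
have zero t : t \in msupp p -> t != d ->
    \prod_(i < n) \sum_(k < N.+1) (-1) ^+ k * 'C(d i, k)%:R * k%:R ^+ t i = 0 :> R.
  move=> /p_homog deg_t ne_td.
  have [i lt_td] : exists i, (t i < d i)%N.
    apply/existsP; apply: contra_neqT ne_td; rewrite negb_exists => /forallP le_dt.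
    by apply/esym/multinom_eq_of_le => // i; rewrite leqNgt.
  rewrite (bigD1 i) //= finite_difference_exp //; last exact: ltnW.
  by rewrite ltn_eqF // !mul0r.
have [d_supp|d_supp] := boolP (d \in msupp p); last first.
  rewrite (memN_msupp_eq0 d_supp) mul0r big_seq big1 // => t t_supp.
  by rewrite zero ?mulr0 //; apply: contraNneq d_supp => <-.
rewrite (bigD1_seq d) ?msupp_uniq //= [X in _ + X]big_seq_cond [X in _ + X]big1 => [|t].
  rewrite addr0; congr (_ * _); apply: eq_bigr => i _.
  by rewrite finite_difference_exp // eqxx mul1r.
by case/andP => t_supp ne_td; rewrite zero ?mulr0.
Qed.

Lemma graph_poly_homog (R : nzRingType) (n : nat) (G : sgraph n) :
  graph_poly R G \is #|edges G|.-homog.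
Proof.
rewrite -sum1_card /graph_poly; elim/big_rec2: _ => [|e d p _ p_homog].
  exact: dhomog1.
by apply: dhomogM => //; rewrite rpredB ?dhomogX /= ?mdeg1.
Qed.

Lemma graph_poly_eval_improper (R : comNzRingType) (n : nat) (G : sgraph n)
    (c : 'I_n -> nat) :
  ~~ proper_coloring G c -> (graph_poly R G).@[fun i => (c i)%:R] = 0.
Proof.
rewrite negb_forall => /existsP[i]; rewrite negb_forall => /existsP[j].
rewrite negb_imply negbK => /andP[].
(* The factors of [graph_poly] are indexed by increasing pairs only. *)
wlog lt_ij : i j / (i < j)%N => [hwlog Gij c_ij | Gij /eqP c_ij].
  have [||eq_ij] := ltngtP i j; first by move/hwlog; apply.
    by move/hwlog; apply; [rewrite adj_sym | rewrite eq_sym].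
  by move: Gij; rewrite (val_inj eq_ij) adj_irrefl.
rewrite /graph_poly (bigD1 (i, j)) /=; last by rewrite inE /= lt_ij.
by rewrite mevalM mevalB !mevalXU c_ij subrr mul0r.
Qed.

Theorem theorem1p7 (R : realType) (n m : nat) (G : sgraph n) (f : 'I_n -> nat)
    (hm : #|edges G| = m)
    (f_gt0 : forall i : 'I_n, (0 < f i)%N)
    (hf : (\sum_(u < n) f u)%N = (m + n)%N) :
  alon_tarsi_choosable R G f <->
  \sum_(c in proper_colorings G f)
     (-1) ^+ (\sum_(i < n) c i)%N *
     (\prod_(i < n) 'C(f i - 1, c i))%N%:R *
     (graph_poly R G).@[fun i : 'I_n => (c i)%:R] != 0 :> R.
Proof.
pose d : 'X_{1..n} := [multinom (f i - 1)%N | i < n].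
have dE i : d i = (f i - 1)%N by rewrite mnmE.
have deg_d : mdeg d = m.
  (* Adding [n] as a sum of ones undoes each truncated subtraction, as [f i > 0]. *)
  apply/eqP; rewrite -(eqn_add2r n) -hf mdegE -[X in (_ + X)%N]card_ord -sum1_card.
  by rewrite -big_split; apply/eqP/eq_bigr => i _ /=; rewrite dE subnK.
have P_homog : graph_poly R G \is (mdeg d).-homog.
  by rewrite deg_d -hm graph_poly_homog.
have -> : alon_tarsi_choosable R G f <-> (graph_poly R G)@_d != 0.
  split=> [[t [t_supp le_td]]|d_supp]; last by exists d; split=> // i; rewrite dE.
  (* A witness [t] has degree [m] by homogeneity and lies below [d], which has the same degree. *)
  suff <- : t = d by [].
  apply: multinom_eq_of_le => [|i]; last by rewrite dE.
  by move/dhomogP: P_homog; apply; rewrite mcoeff_msupp.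
set S := \sum_(c in _) _.
have -> : S = (graph_poly R G)@_d * \prod_(i < n) ((-1) ^+ d i * (d i)`!%:R).
  rewrite -(mcoeff_finite_difference (N := max_color f) P_homog) => [|i]; last first.
    by rewrite dE; apply: (leq_bigmax i).
  rewrite /S big_mkcond; apply: eq_bigr => c _.
  rewrite inE; under [(\prod_(i < n) 'C(d i, c i))%N]eq_bigr do rewrite dE.
  case: ifPn => // c_improper.
  by rewrite (@graph_poly_eval_improper _ _ _ (fun i => c i)) ?mulr0.
(* The signed factorials are nonzero in characteristic zero. *)
rewrite mulf_eq0 negb_or andbC.
suff -> : \prod_(i < n) ((-1) ^+ d i * (d i)`!%:R) != 0 :> R by [].
apply/prodf_neq0 => i _; rewrite mulf_neq0 ?signr_eq0 //.
by rewrite Num.Theory.pnatr_eq0 -lt0n fact_gt0.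
Qed.
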